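(* Let $X$ be a connected graph on $n$ vertices, and let $a,b$ be Laplacian strongly cospectral vertices. Let $\theta^{\pm}$ be the largest element of $\Phi_{ab}^{\pm}$ and $\lambda^{\pm}$ the smallest non-zero element of $\Phi_{ab}^{\pm}$. Then: (i) if $a$ and $b$ are not adjacent, \[\max\left\{\tfrac{n-2}{n}\lambda^+,\ \lambda^-\right\}\le\deg(a)\le\min\left\{\tfrac{n-2}{n}\theta^+,\ \theta^-\right\};\] (ii) if $a$ and $b$ are adjacent, \[\max\left\{\tfrac{n-2}{n}\lambda^++1,\ \lambda^--1\right\}\le\deg(a)\le\min\left\{\tfrac{n-2}{n}\theta^++1,\ \theta^--1\right\}.\]
   Context: Let $L=D-A$ be the Laplacian of $X$ with spectral decomposition $L=\sum_r\mu_rF_r$ ($\mu_r$ the distinct eigenvalues, $F_r$ the orthogonal projection onto the $\mu_r$-eigenspace). Vertices $a,b$ are Laplacian strongly cospectral if $F_re_a=\pm F_re_b$ for every $r$. $\Phi_{ab}^+=\{\mu_r: F_re_a=F_re_b\neq 0\}$ and $\Phi_{ab}^-=\{\mu_r: F_re_a=-F_re_b\neq 0\}$. *)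

(* Defs.v *)
From HB Require Import structures.
From mathcomp Require Import all_boot all_order all_algebra.

Set Implicit Arguments.
Unset Strict Implicit.
Unset Printing Implicit Defensive.

Import Order.TTheory GRing.Theory Num.Theory.
Local Open Scope ring_scope.

(* A simple graph on n vertices is a symmetric irreflexive adjacency relation
   g : rel 'I_n. Since the matrix library computes with row vectors, e_a is a
   row vector and operators act on the right; the matrices involved are
   symmetric, so this agrees with the usual column convention. *)

Definition connected_graph (n : nat) (g : rel 'I_n) : Prop :=
  forall x y : 'I_n, connect g x y.

Definition deg (n : nat) (g : rel 'I_n) (i : 'I_n) : nat :=
  #|[set j | g i j]|.

Definition adjmx (R : rcfType) (n : nat) (g : rel 'I_n) : 'M[R]_n :=
  \matrix_(i, j) (g i j)%:R.

Definition degmx (R : rcfType) (n : nat) (g : rel 'I_n) : 'M[R]_n :=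
  diag_mx (\row_i (deg g i)%:R).

Definition laplacian (R : rcfType) (n : nat) (g : rel 'I_n) : 'M[R]_n :=
  degmx R g - adjmx R g.

(* The row space of kermx U^T is the orthogonal complement of the row space
   of U: it consists of the v with v *m U^T = 0. *)
Definition orth_proj (R : rcfType) (n : nat) (U : 'M[R]_n) : 'M[R]_n :=
  proj_mx U (kermx U^T).

Definition eigenproj (R : rcfType) (n : nat) (g : rel 'I_n) (mu : R) :
    'M[R]_n :=
  orth_proj (eigenspace (laplacian R g) mu).

(* F_mu e_a *)
Definition eigencomp (R : rcfType) (n : nat) (g : rel 'I_n) (mu : R)
    (a : 'I_n) : 'rV[R]_n :=
  delta_mx 0 a *m eigenproj g mu.

Definition strongly_cospectral (R : rcfType) (n : nat) (g : rel 'I_n)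
    (a b : 'I_n) : Prop :=
  forall mu : R, eigenvalue (laplacian R g) mu ->
    eigencomp g mu a = eigencomp g mu b \/
    eigencomp g mu a = - eigencomp g mu b.

Definition Phi_plus (R : rcfType) (n : nat) (g : rel 'I_n) (a b : 'I_n) :
    {pred R} :=
  [pred mu : R | [&& eigenvalue (laplacian R g) mu,
     eigencomp g mu a == eigencomp g mu b & eigencomp g mu a != 0]].

Definition Phi_minus (R : rcfType) (n : nat) (g : rel 'I_n) (a b : 'I_n) :
    {pred R} :=
  [pred mu : R | [&& eigenvalue (laplacian R g) mu,
     eigencomp g mu a == - eigencomp g mu b & eigencomp g mu a != 0]].

Arguments Phi_plus R {n} g a b.
Arguments Phi_minus R {n} g a b.

Definition is_largest (R : rcfType) (S : {pred R}) (x : R) : Prop :=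
  x \in S /\ (forall y, y \in S -> y <= x).

Definition is_smallest_nonzero (R : rcfType) (S : {pred R}) (x : R) : Prop :=
  [/\ x \in S, x != 0 & forall y, y \in S -> y != 0 -> x <= y].

(* Main.v *)
(* Laplacian strong cospectrality puts every non-zero F_r (e_a - e_b) in an
   eigenspace indexed by Phi^-, and every non-zero F_r q, where
   q = e_a + e_b - (2/n) 1, in one indexed by a non-zero element of Phi^+: q is
   orthogonal to 1, which spans ker L because the graph is connected. The
   Rayleigh quotients of these two vectors therefore lie between the extreme
   elements of Phi^- and Phi^+. As deg a = deg b (compare L_aa and L_bb through
   the spectral decomposition), these quotients are deg a + A_ab and,
   for n > 2, (n / (n - 2)) (deg a - A_ab). *)

Require Import Defs.
From HB Require Import structures.
From mathcomp Require Import all_boot all_order all_algebra.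
From mathcomp Require Import complex ring lra.

Set Implicit Arguments.
Unset Strict Implicit.
Unset Printing Implicit Defensive.

Import Order.TTheory GRing.Theory Num.Theory.
Local Open Scope ring_scope.

(** Over [R[i]] the image of [A] is Hermitian, hence similar to a diagonal matrix with real entries.
    Minimal polynomials are compared there, and the comparison descends because mapping polynomials
    along [real_complex] is injective. *)
Lemma symmetric_diagonalizable (R : rcfType) (n : nat) (A : 'M[R]_n) :
  A^T = A -> diagonalizable A.
Proof.
case: n A => [|n] A A_sym; first by rewrite [A]flatmx0; apply: diagonalizable0.
pose f := real_complex R.
have Af_herm : map_mx f A \is hermsymmx.
  apply: realsym_hermsym.
    by apply/is_hermitianmxP/matrixP => i j; rewrite -[in LHS]A_sym !mxE mul1r.
  by apply/mxOverP => i j; rewrite mxE; apply/complex_realP; exists (A i j).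
have [P P_unit [d Af_eq]] : exists2 P, P \in unitmx &
    exists d, map_mx f A = conjmx P (map_mx f (diag_mx d)).
  have /mxOverP := hermitian_spectral_diag_real Af_herm.
  have /orthomx_spectralP := hermitian_normalmx Af_herm.
  move: (spectral_unit (map_mx f A)) (spectral_diag _).
  move: (spectralmx _) => Q Q_unit sp Af_eq sp_real.
  exists (invmx Q); first by rewrite unitmx_inv.
  exists (\row_i complex.Re (sp 0 i)).
  rewrite conjumx ?unitmx_inv // invmxK map_diag_mx Af_eq.
  suff <- : sp = map_mx f (\row_i complex.Re (sp 0 i)) by [].
  by apply/rowP => i; rewrite !mxE /f RRe_real.
have minpolyE : mxminpoly A = mxminpoly (diag_mx d).
  by apply: (map_poly_inj f); rewrite -!mxminpoly_map Af_eq mxminpoly_uconj.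
(* Removing repetitions leaves simple roots, as a minimal polynomial criterion demands. *)
apply/diagonalizableP; exists (undup [seq d 0 i | i <- enum 'I_n.+1]).
  exact: undup_uniq.
by rewrite minpolyE mxminpoly_diag dvdpp.
Qed.

(** * Inner product of row vectors and orthogonal projections *)

Section RowDot.
Variables (R : rcfType) (n : nat).
Implicit Types (u v w : 'rV[R]_n).

Definition rdot u v : R := (u *m v^T) 0 0.

Lemma rdotE u v : rdot u v = \sum_i u 0 i * v 0 i.
Proof. by rewrite /rdot mxE; apply: eq_bigr => i _; rewrite mxE. Qed.

Lemma rdotC u v : rdot u v = rdot v u.
Proof. by rewrite !rdotE; apply: eq_bigr => i _; rewrite mulrC. Qed.

Lemma rdotDl u v w : rdot (u + v) w = rdot u w + rdot v w.
Proof. by rewrite /rdot mulmxDl mxE. Qed.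

Lemma rdotZl c u v : rdot (c *: u) v = c * rdot u v.
Proof. by rewrite /rdot -scalemxAl mxE. Qed.

Lemma rdotNl u v : rdot (- u) v = - rdot u v.
Proof. by rewrite -scaleN1r rdotZl mulN1r. Qed.

Lemma rdotBl u v w : rdot (u - v) w = rdot u w - rdot v w.
Proof. by rewrite rdotDl rdotNl. Qed.

Lemma rdotDr u v w : rdot u (v + w) = rdot u v + rdot u w.
Proof. by rewrite -!(rdotC _ u) rdotDl. Qed.

Lemma rdotNr u v : rdot u (- v) = - rdot u v.
Proof. by rewrite -!(rdotC _ u) rdotNl. Qed.

Lemma rdotBr u v w : rdot u (v - w) = rdot u v - rdot u w.
Proof. by rewrite rdotDr rdotNr. Qed.

Lemma rdotZr c u v : rdot u (c *: v) = c * rdot u v.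
Proof. by rewrite -!(rdotC _ u) rdotZl. Qed.

Lemma rdot_suml (I : Type) (r : seq I) (F : I -> 'rV[R]_n) v :
  rdot (\sum_(i <- r) F i) v = \sum_(i <- r) rdot (F i) v.
Proof. by rewrite /rdot mulmx_suml summxE. Qed.

Lemma rdot_ge0 u : 0 <= rdot u u.
Proof. by rewrite rdotE sumr_ge0 // => i _; rewrite -expr2 sqr_ge0. Qed.

Lemma rdot_eq0 u : (rdot u u == 0) = (u == 0).
Proof.
apply/idP/eqP => [|->]; last by rewrite /rdot mul0mx mxE.
rewrite rdotE psumr_eq0 => [/allP u0|i _]; last by rewrite -expr2 sqr_ge0.
apply/rowP => i; rewrite mxE; apply/eqP.
by have := u0 i (mem_index_enum i); rewrite mulf_eq0 orbb.
Qed.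

Lemma rdot_mulmxl (A : 'M[R]_n) u v : rdot (u *m A) v = rdot u (v *m A^T).
Proof. by rewrite /rdot trmx_mul trmxK mulmxA. Qed.

(** A vector in both spaces is orthogonal to itself, so it vanishes by positive definiteness. *)
Lemma capmx_orth (U : 'M[R]_n) : (U :&: kermx U^T = 0)%MS.
Proof.
apply/eqP/rowV0P => v; rewrite sub_capmx.
case/andP=> /submxP[w v_def] /sub_kermxP vU.
by apply/eqP; rewrite -rdot_eq0 /rdot {2}v_def trmx_mul mulmxA vU mul0mx mxE.
Qed.


Lemma addsmx_orth (U : 'M[R]_n) : (U + kermx U^T :=: 1%:M)%MS.
Proof.
apply/eqmxP; rewrite submx1 sub1mx /row_full.
by rewrite (mxrank_disjoint_sum (capmx_orth U)) mxrank_ker mxrank_tr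
  subnKC ?rank_leq_row ?eqxx.
Qed.

Lemma orth_proj_sub (U : 'M[R]_n) v : (v *m orth_proj U <= U)%MS.
Proof. exact: proj_mx_sub. Qed.

Lemma orth_proj_id (U : 'M[R]_n) v : (v <= U)%MS -> v *m orth_proj U = v.
Proof. by apply: proj_mx_id; apply: capmx_orth. Qed.

Lemma orth_proj_0 (U : 'M[R]_n) v : v *m U^T = 0 -> v *m orth_proj U = 0.
Proof.
by move=> vU; apply: proj_mx_0; [apply: capmx_orth | apply/sub_kermxP].
Qed.

(** The residual of [v] lies in [kermx U^T], hence is orthogonal to [w]. *)
Lemma rdot_orth_proj (U : 'M[R]_n) v w :
  (w <= U)%MS -> rdot w (v *m orth_proj U) = rdot w v.
Proof.
case/submxP => x ->; have vU : (v <= U + kermx U^T)%MS.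
  by rewrite addsmx_orth submx1.
have /sub_kermxP := proj_mx_compl_sub vU; rewrite mulmxBl => /eqP.
rewrite subr_eq0 => /eqP e.
by rewrite !rdot_mulmxl /orth_proj -e.
Qed.

(** * Spectral decomposition and Rayleigh bounds for symmetric matrices *)

Section SymmetricMatrix.
Variable A : 'M[R]_n.
Hypothesis A_sym : A^T = A.

Local Notation E mu := (orth_proj (eigenspace A mu)).

Lemma orth_proj_eigenspace_0 v mu nu :
  v *m A = nu *: v -> nu != mu -> v *m E mu = 0.
Proof.
move=> vA nu_mu; apply: orth_proj_0.
have /eigenspaceP UA := submx_refl (eigenspace A mu).
(* By symmetry [A] can act on either side of the pairing, giving [nu] or [mu]; as these differ, the
   pairing is zero. *)
have: nu *: (v *m (eigenspace A mu)^T) = mu *: (v *m (eigenspace A mu)^T).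
  by rewrite scalemxAl -vA -mulmxA -{1}A_sym -trmx_mul UA linearZ scalemxAr.
move/eqP; rewrite -subr_eq0 -scalerBl scaler_eq0 subr_eq0 (negPf nu_mu) /=.
by move/eqP.
Qed.

(** A decomposition of [v] into eigenvectors is recovered by the projections: each fixes its own
    summand and kills the others. One list [rs] serves all [v], so that two vectors can later be
    compared termwise. *)
Lemma eigen_resolution :
  exists rs : seq R, forall v, v = \sum_(mu <- rs) v *m E mu.
Proof.
have /diagonalizablePeigen[rs rs_uniq rs_full] :=
  symmetric_diagonalizable A_sym.
exists rs => v; have: (v <= \sum_(mu <- rs) eigenspace A mu)%MS.
  by rewrite rs_full submx1.
rewrite (big_nth 0) big_mkord => /sub_sumsmxP[w v_def].
rewrite (big_nth 0) big_mkord {1}v_def; apply: eq_bigr => i _.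
rewrite v_def mulmx_suml (bigD1 i) //= orth_proj_id ?submxMl //.
rewrite big1 ?addr0 // => j j_i; apply: (orth_proj_eigenspace_0 (nu := rs`_j)).
  by apply/eigenspaceP; rewrite submxMl.
by rewrite nth_uniq.
Qed.

Lemma rdot_spectral (rs : seq R) v :
    v = \sum_(mu <- rs) v *m E mu ->
  rdot v v = \sum_(mu <- rs) rdot (v *m E mu) (v *m E mu) /\
  rdot (v *m A) v = \sum_(mu <- rs) mu * rdot (v *m E mu) (v *m E mu).
Proof.
move=> v_def; have Ev mu := orth_proj_sub (eigenspace A mu) v.
split.
  by rewrite {1}v_def rdot_suml; apply: eq_bigr => mu _; rewrite rdot_orth_proj.
rewrite {1}v_def mulmx_suml rdot_suml; apply: eq_bigr => mu _.
by rewrite rdot_orth_proj // (eigenspaceP (Ev mu)) rdotZl.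
Qed.

(** Eigenvalues with zero component contribute nothing to either side, so only those on the support
    of [v] need a bound. *)
Lemma rayleigh_le v c :
  (forall mu, v *m E mu != 0 -> mu <= c) -> rdot (v *m A) v <= c * rdot v v.
Proof.
move=> v_le; have [rs rsP] := eigen_resolution.
have [-> ->] := rdot_spectral (rsP v); rewrite mulr_sumr.
apply: ler_sum => mu _; have [->|/v_le] := eqVneq (v *m E mu) 0.
  by rewrite [rdot 0 0]/rdot mul0mx mxE !mulr0.
by move=> mu_c; rewrite ler_wpM2r ?rdot_ge0.
Qed.

Lemma rayleigh_ge v c :
  (forall mu, v *m E mu != 0 -> c <= mu) -> c * rdot v v <= rdot (v *m A) v.
Proof.
move=> v_ge; have [rs rsP] := eigen_resolution.
have [-> ->] := rdot_spectral (rsP v); rewrite mulr_sumr.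
apply: ler_sum => mu _; have [->|/v_ge] := eqVneq (v *m E mu) 0.
  by rewrite [rdot 0 0]/rdot mul0mx mxE !mulr0.
by move=> mu_c; rewrite ler_wpM2r ?rdot_ge0.
Qed.

End SymmetricMatrix.
End RowDot.

(** * The graph Laplacian and its kernel *)

Section Laplacian.
Variables (R : rcfType) (n : nat) (g : rel 'I_n).
Hypotheses (g_sym : symmetric g) (g_irr : irreflexive g).

Local Notation L := (laplacian R g).
Local Notation e i := (delta_mx 0 i : 'rV[R]_n).
Local Notation one := (const_mx 1 : 'rV[R]_n).

Lemma laplacianE i j : L i j = (deg g i)%:R *+ (i == j) - (g i j)%:R.
Proof. by rewrite !mxE. Qed.

Lemma laplacian_sym : L^T = L.
Proof.
apply/matrixP => i j; rewrite mxE !laplacianE g_sym eq_sym.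
by case: eqP => // ->.
Qed.

Lemma degE i : (deg g i)%:R = \sum_j (g i j)%:R :> R.
Proof.
rewrite /deg -sum1_card natr_sum big_mkcond /=; apply: eq_bigr => j _.
by rewrite inE; case: (g i j).
Qed.

Lemma mul_laplacian (v : 'rV[R]_n) j :
  (v *m L) 0 j = \sum_i (g j i)%:R * (v 0 j - v 0 i).
Proof.
rewrite mxE; under eq_bigr do rewrite laplacianE mulrBr.
under [RHS]eq_bigr do rewrite mulrBr.
rewrite !big_split /= -mulr_suml -degE; congr (_ + _).
  rewrite (bigD1 j) //= eqxx big1 ?addr0 1?mulrC // => i /negPf->.
  by rewrite mulr0.
by apply: eq_bigr => i _; rewrite mulrC g_sym.
Qed.

Lemma ones_laplacian : one *m L = 0.
Proof.
apply/rowP => j; rewrite mul_laplacian [RHS]mxE big1 // => i _.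
by rewrite !mxE subrr mulr0.
Qed.

(** Maximum principle: at a maximal entry, [mul_laplacian] is a zero sum of non-negative terms, so
    all neighbours are maximal too, and connectedness spreads this to every vertex. *)
Lemma laplacian_ker (v : 'rV[R]_n) i j :
  connected_graph g -> v *m L = 0 -> v 0 i = v 0 j.
Proof.
move=> g_conn vL.
have [m _ m_max] := @arg_maxP _ _ _ i xpredT (fun k => v 0 k) isT.
have v_closed : closed g [pred k | v 0 k == v 0 m].
  apply: intro_closed => [|x y gxy]; first exact: sym_connect_sym.
  rewrite !inE => /eqP vx.
  have /eqP := congr1 (fun w : 'rV_n => w 0 x) vL.
  rewrite mul_laplacian [X in _ == X]mxE psumr_eq0 => [/allP|k _].
    move/(_ y (mem_index_enum y)).
    by rewrite gxy mul1r subr_eq0 vx eq_sym.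
  by rewrite mulr_ge0 ?ler0n // subr_ge0 vx; apply: m_max.
have eq_m k : v 0 k = v 0 m.
  apply/eqP; have := closed_connect v_closed (g_conn m k).
  by rewrite !inE eqxx => <-.
by rewrite !eq_m.
Qed.

Lemma rdot_delta (v : 'rV[R]_n) i : rdot v (e i) = v 0 i.
Proof.
rewrite rdotE (bigD1 i) //= mxE !eqxx mulr1 big1 ?addr0 // => j /negPf j_i.
by rewrite mxE j_i andbF mulr0.
Qed.

Lemma rdot_laplacian_delta i j : rdot (e i *m L) (e j) = L i j.
Proof. by rewrite rdot_delta -rowE mxE. Qed.


Lemma eigencomp_neq0_eigenvalue mu i :
  eigencomp g mu i != 0 :> 'rV[R]_n -> eigenvalue L mu.
Proof.
apply: contraNN => /eqP E0; rewrite -submx0 -E0; exact: orth_proj_sub.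
Qed.

(** * Strong cospectrality and the two test vectors *)

Section StronglyCospectral.
Variables a b : 'I_n.
Hypothesis ab_sc : strongly_cospectral R g a b.

(** Off the spectrum both components are zero, so sums over [rs] need no check that [mu] is an
    eigenvalue. *)
Lemma eigencomp_eqVopp (mu : R) :
  eigencomp g mu a = eigencomp g mu b \/ eigencomp g mu a = - eigencomp g mu b.
Proof.
have [/ab_sc //|no_mu] := boolP (eigenvalue L mu).
have comp0 i : eigencomp g mu i = 0 :> 'rV[R]_n.
  by apply/eqP; apply: contraNT no_mu; apply: eigencomp_neq0_eigenvalue.
by left; rewrite !comp0.
Qed.

Lemma strongly_cospectral_deg : deg g a = deg g b.
Proof.
apply/eqP; rewrite -(eqr_nat R); apply/eqP.
have degLE i : (deg g i)%:R = rdot (e i *m L) (e i).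
  by rewrite rdot_laplacian_delta laplacianE eqxx g_irr subr0.
have [rs rsP] := eigen_resolution laplacian_sym.
rewrite !degLE; have [_ ->] := rdot_spectral (rsP (e a)).
have [_ ->] := rdot_spectral (rsP (e b)).
apply: eq_bigr => mu _; congr (_ * _).
have := eigencomp_eqVopp mu; rewrite /eigencomp /eigenproj.
by case=> ->; rewrite ?rdotNl ?rdotNr ?opprK.
Qed.

Lemma Phi_minus_neq (mu : R) : mu \in Phi_minus R g a b -> a != b.
Proof.
rewrite inE => /and3P[_ /eqP mu_opp]; apply: contraNneq => ab.
move: mu_opp; rewrite -ab => /eqP; rewrite -addr_eq0 -mulr2n.
by rewrite -scaler_nat scaler_eq0 pnatr_eq0.
Qed.

Lemma eigencomp0_sum i : rdot (eigencomp g 0 i) one = 1.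
Proof.
rewrite rdotC rdot_orth_proj; first by rewrite rdot_delta mxE.
by apply/eigenspaceP; rewrite ones_laplacian scale0r.
Qed.

(** Projecting onto the kernel preserves the coordinate sum, so both components at 0 have sum 1 and
    cannot be opposite. *)
Lemma Phi_minus_neq0 (mu : R) : mu \in Phi_minus R g a b -> mu != 0.
Proof.
rewrite inE => /and3P[_ /eqP mu_opp _]; apply/eqP => mu0.
have := eigencomp0_sum a; rewrite -mu0 mu_opp mu0 rdotNl eigencomp0_sum.
lra.
Qed.

Lemma mem_Phi_minus (mu : R) :
  (e a - e b) *m eigenproj g mu != 0 -> mu \in Phi_minus R g a b.
Proof.
rewrite mulmxBl -!/(eigencomp _ _ _) subr_eq0 => neq.
have [eq|opp] := eigencomp_eqVopp mu; first by rewrite eq eqxx in neq.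
have neq0 : eigencomp g mu a != 0.
  apply: contraNneq neq => a0.
  by rewrite eq_sym -[eigencomp g mu b]opprK -opp a0 oppr0.
by rewrite inE opp eqxx -opp neq0 (eigencomp_neq0_eigenvalue neq0).
Qed.

Hypothesis g_conn : connected_graph g.
Local Notation q := (e a + e b - (2 / n%:R) *: one).

Lemma n_neq0 : n%:R != 0 :> R.
Proof. by rewrite pnatr_eq0 -lt0n; case: n a => [[]|]. Qed.

Lemma rdot_ones : rdot one one = n%:R.
Proof.
rewrite rdotE (eq_bigr (fun=> 1)) ?sumr_const ?card_ord // => i _.
by rewrite !mxE mulr1.
Qed.

Lemma mem_Phi_plus (mu : R) : q *m eigenproj g mu != 0 ->
  mu != 0 /\ mu \in Phi_plus R g a b.
Proof.
have one_ker : one *m L = 0 *: one by rewrite ones_laplacian scale0r.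
have [-> /eqP[]|mu0 neq] := eqVneq mu 0; last split=> //.
  (* At [mu = 0] the projection [w] of [q] is constant, by connectedness, and orthogonal to [one];
     hence it is zero. *)
  set w := _ *m _; have w0 : w *m L = 0.
    have /eigenspaceP := orth_proj_sub (eigenspace L 0) q.
    by rewrite scale0r.
  have w_one : rdot one w = 0.
    rewrite rdot_orth_proj; last by apply/eigenspaceP.
    rewrite rdotBr rdotDr !rdot_delta rdotZr rdot_ones !mxE divfK ?n_neq0 //.
    by rewrite subrr.
  have w_const : w = w 0 a *: one.
    apply/rowP => i; rewrite [RHS]mxE [one 0 i]mxE mulr1.
    exact: laplacian_ker.
  move: w_one; rewrite w_const rdotZr rdot_ones => /eqP.
  by rewrite mulf_eq0 (negPf n_neq0) orbF => /eqP ->; rewrite scale0r.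
(* For [mu != 0] the projection kills [one], so [q] and [e a + e b] have the same component. *)
have one_E : one *m eigenproj g mu = 0.
  by apply: (orth_proj_eigenspace_0 laplacian_sym one_ker); rewrite eq_sym.
move: neq; rewrite mulmxBl -scalemxAl one_E scaler0 subr0 mulmxDl.
rewrite -!/(eigencomp _ _ _) addr_eq0 => neq.
have [eq|opp] := eigencomp_eqVopp mu; last by rewrite opp eqxx in neq.
have neq0 : eigencomp g mu a != 0.
  by apply: contraNneq neq => a0; rewrite -eq a0 oppr0.
by rewrite inE eq eqxx -eq neq0 (eigencomp_neq0_eigenvalue neq0).
Qed.

Hypothesis a_neq_b : a != b.

Lemma rdot_delta_delta i j : rdot (e i) (e j) = (i == j)%:R.
Proof. by rewrite rdot_delta mxE eqxx eq_sym. Qed.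

Lemma rdot_minus : rdot (e a - e b) (e a - e b) = 2.
Proof.
rewrite !(rdotBl, rdotBr) !rdot_delta_delta !eqxx (eq_sym b) (negPf a_neq_b).
by rewrite /=; ring.
Qed.

Lemma rdot_laplacian_minus :
  rdot ((e a - e b) *m L) (e a - e b) = 2 * ((deg g a)%:R + (g a b)%:R).
Proof.
rewrite mulmxBl !(rdotBl, rdotBr) !rdot_laplacian_delta !laplacianE !eqxx.
rewrite (eq_sym b) (negPf a_neq_b) !g_irr (g_sym b) strongly_cospectral_deg.
by rewrite /=; ring.
Qed.

Lemma rdot_plus : rdot q q = 2 * ((n%:R - 2) / n%:R).
Proof.
have one_e i : rdot one (e i) = 1 by rewrite rdot_delta mxE.
rewrite !(rdotBl, rdotBr, rdotDl, rdotDr, rdotNl, rdotNr, rdotZl, rdotZr).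
rewrite ![rdot (e _) one]rdotC !one_e !rdot_delta_delta !eqxx.
rewrite rdot_ones (eq_sym b) (negPf a_neq_b).
by rewrite /=; field; exact: n_neq0.
Qed.

(** Since [one] is in the kernel of the symmetric [L], the quadratic form at [q] is that at
    [e a + e b]. *)
Lemma rdot_laplacian_plus : rdot (q *m L) q = 2 * ((deg g a)%:R - (g a b)%:R).
Proof.
rewrite mulmxBl -scalemxAl ones_laplacian scaler0 subr0 rdotBr rdotZr.
rewrite [rdot _ one]rdot_mulmxl laplacian_sym ones_laplacian.
rewrite [rdot _ 0]rdotC [rdot 0 _]/rdot mul0mx mxE mulr0 subr0.
rewrite mulmxDl !(rdotDl, rdotDr) !rdot_laplacian_delta !laplacianE !eqxx.
rewrite (eq_sym b) (negPf a_neq_b) !g_irr (g_sym b) strongly_cospectral_deg.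
by rewrite /=; ring.
Qed.

End StronglyCospectral.
End Laplacian.

(* The hypothesis on lambda_p is conditional because Phi_plus = {0} when the
   graph is K_2; then lambda_p is arbitrary, its coefficient (n - 2) / n being
   zero. The other three extrema exist as soon as a and b are distinct. *)
Theorem theorem6p5 (R : rcfType) (n : nat) (g : rel 'I_n)
    (g_sym : symmetric g) (g_irr : irreflexive g)
    (g_conn : connected_graph g) (a b : 'I_n)
    (ab_sc : strongly_cospectral R g a b)
    (theta_p theta_m lambda_p lambda_m : R)
    (h_theta_p : is_largest (Phi_plus R g a b) theta_p)
    (h_theta_m : is_largest (Phi_minus R g a b) theta_m)
    (h_lambda_p :
       (exists2 mu : R, mu \in Phi_plus R g a b & mu != 0) ->
       is_smallest_nonzero (Phi_plus R g a b) lambda_p)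
    (h_lambda_m : is_smallest_nonzero (Phi_minus R g a b) lambda_m) :
  (~~ g a b ->
     Num.max ((n%:R - 2) / n%:R * lambda_p) lambda_m <= (deg g a)%:R
       <= Num.min ((n%:R - 2) / n%:R * theta_p) theta_m) /\
  (g a b ->
     Num.max ((n%:R - 2) / n%:R * lambda_p + 1) (lambda_m - 1) <= (deg g a)%:R
       <= Num.min ((n%:R - 2) / n%:R * theta_p + 1) (theta_m - 1)).
Proof.
have [tp_in tp_max] := h_theta_p; have [tm_in tm_max] := h_theta_m.
have [lm_in lm0 lm_min] := h_lambda_m.
have a_neq_b := Phi_minus_neq tm_in.
have L_sym := laplacian_sym R g_sym.
have minus_le := rayleigh_le L_sym (fun mu h =>
  tm_max mu (mem_Phi_minus ab_sc h)).
have minus_ge := rayleigh_ge L_sym (fun mu h =>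
  let mu_in := mem_Phi_minus ab_sc h in
  lm_min mu mu_in (Phi_minus_neq0 g_sym mu_in)).
have plus_le := rayleigh_le L_sym (fun mu h =>
  tp_max mu (mem_Phi_plus g_sym ab_sc g_conn h).2).
(* Any [mu] in the support of [q] is itself the witness that releases [h_lambda_p]; if the support
   is empty, nothing is asked of [lambda_p]. *)
have plus_ge := rayleigh_ge L_sym (fun mu h =>
  let: conj mu0 mu_in := mem_Phi_plus g_sym ab_sc g_conn h in
  let: And3 _ _ lp_min := h_lambda_p (ex_intro2 _ _ mu mu_in mu0) in
  lp_min mu mu_in mu0).
rewrite rdot_minus // rdot_laplacian_minus // in minus_le minus_ge.
rewrite rdot_plus // rdot_laplacian_plus // in plus_le plus_ge.
(* The ratio (n - 2) / n is only ever multiplied by, so [n = 2], where [q = 0], needs no separate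
   case. *)
move: (_ / _) plus_le plus_ge => c plus_le plus_ge.
split=> gab; rewrite ge_max le_min; move: minus_le minus_ge plus_le plus_ge.
  by rewrite (negPf gab) /= => *; apply/andP; split; apply/andP; split; lra.
by rewrite gab /= => *; apply/andP; split; apply/andP; split; lra.
Qed.
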